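(* Consider an abrupt power loss at a bus $b$ of the network, $\delta P_i(t)=\delta_{ib}\,\delta P\,\Theta(t)$. Let the inertia be homogeneous, $\bm M=m\,\mathbb 1$ with $m>0$ (so $m_b=m$), and let the damping ratios be weakly inhomogeneous: $\gamma_i=d_i/m_i=\gamma+\delta\gamma\,a_i$, i.e. $\bm\Gamma=\mathrm{diag}(\gamma_i)=\gamma\,[\mathbb 1+g\,\mathrm{diag}(a_i)]$, where $g=\delta\gamma/\gamma\ll 1$ is a small dimensionless parameter, $-1\le a_i\le 1$ and $\sum_i a_i=0$. Then, to leading order in $g$, the optimal distribution of the parameters $\{a_i\}$ that minimizes the performance measure $\mathcal M_b$ is obtained as follows. (1) Compute the sensitivities $\alpha_i=\partial\mathcal M_b/\partial a_i$ from the formula $$\alpha_i=-\frac{g\,\delta P^2}{2\gamma m_b}\Bigg[\sum_{\alpha>1}\frac{u_{\alpha i}^2u_{\alpha b}^2}{\lambda_\alpha}+\sum_{\alpha>1,\ \beta\neq\alpha}\frac{u_{\alpha i}\,u_{\alpha b}\,u_{\beta i}\,u_{\beta b}}{(\lambda_\alpha-\lambda_\beta)^2+2\gamma^2(\lambda_\alpha+\lambda_\beta)}\Bigg].$$ (2) Sort the set $\{\alpha_i\}$ in ascending order (relabeling the buses accordingly). (3) In this ordering, set $a_i=1$ for $i=1,\dots,\mathrm{Int}[N/2]$ and $a_i=-1$ for $i=N-\mathrm{Int}[N/2]+1,\dots,N$ (if $N$ is odd, the remaining middle parameter is $a_i=0$). The optimal placement of primary control is given by $d_i=m(\gamma+\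delta\gamma\,a_i)$.
   Context: Setting: a connected electric power grid with $N$ buses, bus $i$ having inertia $m_i$ and damping (primary control) $d_i$; $\bm M=\mathrm{diag}(m_i)$, $\bm D=\mathrm{diag}(d_i)$. Given line susceptances $B_{ij}$ and a stationary power flow solution with voltage angles $\theta_i^{(0)}$, the network Laplacian $\bm L$ has entries $L_{ij}=-B_{ij}\cos(\theta_i^{(0)}-\theta_j^{(0)})$ for $i\ne j$ and $L_{ii}=\sum_k B_{ik}\cos(\theta_i^{(0)}-\theta_k^{(0)})$. The linearized dynamics of the angle deviations $\delta\bm\theta$ and frequencies $\bm\omega=\dot{\delta\bm\theta}$ is $$\bm M\dot{\bm\omega}+\bm D\bm\omega=\delta\bm P(t)-\bm L\,\delta\bm\theta,$$ started from the stationary state, $\delta\bm\theta(0)=\bm\omega(0)=0$. Here $\Theta$ is the Heaviside step function ($\Theta(t)=1$ for $t>0$, $0$ for $t<0$), $\delta_{ib}$ is the Kronecker symbol, $\delta P$ is the size of the power loss, $\mathbb 1$ is the $N\times N$ identity matrix, and $\mathrm{Int}[\cdot]$ is the integer part. Spectral data: $\bm L_{\bm M}=\bm M^{-1/2}\bm L\bm M^{-1/2}$ is the inertia-weighted Laplacian, a real symmetric matrix (equal to $m^{-1}\bm L$ when $\bm M=m\mathbb 1$). Its eigenvalues are $\lambda_1=0$ and $\lambda_\alpha<\lambda_{\alpha+1}$ for $\alpha=1,\dots,N-1$, and $u_{\alpha i}$, $i=1,\dots,N$, are the components of the $\alpha$-th eigenvector in an orthonormal eigenbasis. Greek summation indices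 label eigenmodes $1,\dots,N$ with the stated restrictions; the symbol $\alpha_i$ with a bus index $i$ denotes a sensitivity. Performance measure: $\mathcal M_b=\int_0^\infty(\bm\omega-\bar{\bm\omega})^\top\bm M(\bm\omega-\bar{\bm\omega})\,dt$ for the abrupt power loss at bus $b$, where all components of $\bar{\bm\omega}$ equal $\omega_{\rm sys}(t)=\sum_i m_i\omega_i(t)/\sum_i m_i$. The sensitivities $\alpha_i$ are the coefficients of the parameters $a_i$ in the expansion of $\mathcal M_b$ to linear order in $g$.
   Formalization: The printed formula for the sensitivities is off by a factor: each term of the second (double) sum over α>1, β≠α must be multiplied by 4γ² for α_i to equal ∂M_b/∂a_i; the theorem is proved with that factor. *)

(* Defs.v *)
From HB Require Import structures.
From mathcomp Require Import all_boot all_order all_algebra all_fingroup.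
From mathcomp Require Import all_classical all_reals all_analysis.

Set Implicit Arguments.
Unset Strict Implicit.
Unset Printing Implicit Defensive.

Import Order.TTheory GRing.Theory Num.Theory.
Import numFieldNormedType.Exports.

Local Open Scope classical_set_scope.
Local Open Scope ring_scope.

(* Buses and eigenmodes are both indexed by 'I_N, so the mode written 1 in
   one-based numbering is the ordinal of value 0, and "alpha > 1" reads
   (0 < al)%N. *)

Section Network.
Variables (R : realType) (N : nat).
Implicit Types (B L : 'M[R]_N) (mi d : 'I_N -> R).

(* Susceptances of a connected grid; an absent line has susceptance 0. *)
Definition connected_grid B :=
  [/\ B^T = B, forall i, B i i = 0 &
      forall i j, connect [rel k l | B k l != 0] i j].

Definition laplacian B (th0 : 'I_N -> R) : 'M[R]_N :=
  \matrix_(i, j)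
    if i == j then \sum_k B i k * cos (th0 i - th0 k)
    else - (B i j * cos (th0 i - th0 j)).

Definition diag_of (x : 'I_N -> R) : 'M[R]_N := diag_mx (\row_i x i).

Definition inertia_weighted mi L : 'M[R]_N :=
  let Mr := diag_of (fun i => (Num.sqrt (mi i))^-1) in Mr *m L *m Mr.

(* Row al of u is the al-th eigenvector, so u al i is its i-th component. *)
Definition spectral_data (LM : 'M[R]_N) (lam : 'I_N -> R) (u : 'M[R]_N) :=
  [/\ u *m u^T = 1%:M,
      forall al, LM *m (row al u)^T = lam al *: (row al u)^T,
      forall al : 'I_N, val al = 0%N -> lam al = 0 &
      forall al be : 'I_N, (al < be)%N -> lam al < lam be].

Definition heaviside (t : R) : R := if 0 < t then 1 else 0.

Definition power_loss (b : 'I_N) (dP : R) (t : R) : 'cV[R]_N :=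
  \col_i ((i == b)%:R * dP * heaviside t).

Definition cderivable (x : R -> 'cV[R]_N) (t : R) :=
  forall i, derivable (fun s => x s i 0) t 1.

Definition cderive (x : R -> 'cV[R]_N) (t : R) : 'cV[R]_N :=
  \col_i derive1 (fun s => x s i 0) t.

(* The forcing jumps at t = 0: the equations hold for t > 0 and the initial
   state is attained continuously from the right.  Values at t < 0 are
   irrelevant. *)
Definition response L mi d (P : R -> 'cV[R]_N) (dth om : R -> 'cV[R]_N) :=
  [/\ dth 0 = 0, om 0 = 0,
      forall i, {within `[0, +oo[, continuous (fun t => dth t i 0)},
      forall i, {within `[0, +oo[, continuous (fun t => om t i 0)} &
      forall t, 0 < t ->
        [/\ cderivable dth t, cderivable om t, cderive dth t = om t &
            diag_of mi *m cderive om t + diag_of d *m om t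
              = P t - L *m dth t]].

Definition sys_freq mi (om : R -> 'cV[R]_N) (t : R) : R :=
  (\sum_i mi i * om t i 0) / \sum_i mi i.

Definition performance mi (om : R -> 'cV[R]_N) : \bar R :=
  \int[@lebesgue_measure R]_(t in `[0, +oo[)
    (let x := om t - const_mx (sys_freq mi om t) in
     (x^T *m diag_of mi *m x) 0 0)%:E.

End Network.

Section Placement.
Variables (R : realType) (N : nat).
Implicit Types (a : 'I_N -> R) (F : R -> ('I_N -> R) -> \bar R)
  (alpha : R -> 'I_N -> R).

Definition placement (m gam dgam : R) a : 'I_N -> R :=
  fun i => m * (gam + dgam * a i).

Definition in_box a := forall i, -1 <= a i <= 1.

Definition admissible a := in_box a /\ \sum_i a i = 0.

(* F g a = M0 + \sum_i alpha_i(g) a_i + o(g), where alpha_i is linear in g and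
   the remainder is uniform over the box.  The constraint \sum_i a_i = 0 is not
   imposed here, because it would only determine the alpha_i up to a common
   constant.  As M0 is real, F g a is finite wherever the bound holds. *)
Definition are_sensitivities F alpha :=
  (forall g i, alpha g i = g * alpha 1 i) /\
  exists M0 : R, forall e : R, 0 < e -> exists2 dlt : R, 0 < dlt &
    forall g a, `|g| < dlt -> in_box a ->
      (`| F g a - (M0 + \sum_i alpha g i * a i)%:E | <= (e * `|g|)%:E)%E.

(* s lists the buses by ascending sensitivity, ties being broken arbitrarily. *)
Definition ascending (al : 'I_N -> R) (s : 'S_N) :=
  forall i j : 'I_N, (i <= j)%N -> al (s i) <= al (s j).

Definition sorted_assignment (s : 'S_N) a :=
  forall i : 'I_N,
    a (s i) = if (i < N./2)%N then 1
              else if (N - N./2 <= i)%N then -1 else 0.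

(* a minimizes the expansion of F truncated at linear order in g. *)
Definition minimizes_linear_order (al : 'I_N -> R) a :=
  admissible a /\
  forall a', admissible a' -> \sum_i al i * a i <= \sum_i al i * a' i.

(* C g is the set of distributions proposed at g: each of them minimizes F g
   over the admissible distributions up to an error o(g). *)
Definition optimal_to_leading_order F (C : R -> set ('I_N -> R)) :=
  forall e : R, 0 < e -> exists2 dlt : R, 0 < dlt &
    forall g a, `|g| < dlt -> C g a ->
      admissible a /\
      forall a', admissible a' -> (F g a <= F g a' + (e * `|g|)%:E)%E.

(* The factor 4 gamma^2 of the double sum makes both sums commensurate (lam and
   gam^2 have the same physical dimension) and makes the terms with
   lam be -> lam al tend to those of the first sum.  It comes from
   \int_0^oo x y = 1 / ((l - l')^2 + 2 gam^2 (l + l')), where x and y have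
   Laplace transforms 1/(s^2 + gam s + l) and
   s/((s^2 + gam s + l)(s^2 + gam s + l')). *)
Definition sensitivity (m gam dP : R) (lam : 'I_N -> R) (u : 'M[R]_N)
    (b : 'I_N) (g : R) (i : 'I_N) : R :=
  - (g * dP ^+ 2 / (2 * gam * m)) *
  (\sum_(al < N | (0 < al)%N) u al i ^+ 2 * u al b ^+ 2 / lam al +
   \sum_(al < N | (0 < al)%N) \sum_(be < N | be != al)
      4 * gam ^+ 2 * (u al i * u al b * u be i * u be b) /
      ((lam al - lam be) ^+ 2 + 2 * gam ^+ 2 * (lam al + lam be))).

End Placement.

(* Main.v *)
(* The angular accelerations [v = om'] and the frequencies satisfy a homogeneous
   linear system whose initial state [om = 0], [v = (dP / m) e_b] does not depend
   on the damping.  In the eigenbasis of the Laplacian the modes decouple at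
   [g = 0], and there an explicit quadratic form [W0 + g W1] solves the Lyapunov
   equation of the integrand up to order [g ^ 2]: along the true trajectories its
   derivative is [- \sum_(al > 0) om_al ^ 2 + g ^ 2 R], with [R] quadratic.  A
   second, strict Lyapunov function controls the integral of [R] uniformly in
   the damping, so the performance is [m * (W0 + g W1)] at the initial state up
   to [O(g ^ 2)].  The linear functional so obtained is minimized over the box,
   under the zero-sum constraint, by comparison with the median sensitivity. *)
Require Import Defs.
From HB Require Import structures.
From mathcomp Require Import all_boot all_order all_algebra all_fingroup.
From mathcomp Require Import all_classical all_reals all_analysis.
From mathcomp Require Import measurable_realfun.
From mathcomp Require Import zify ring lra.
Import Order.TTheory GRing.Theory Num.Theory.
Import numFieldNormedType.Exports.
Local Open Scope classical_set_scope.
Local Open Scope ring_scope.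

(** * Differential calculus on the closed half-line *)

Definition C1y {R : realType} (x dx : R -> R) :=
  [/\ {within `[0, +oo[, continuous x}, {within `[0, +oo[, continuous dx} &
      forall t : R, 0 < t -> is_derive t 1 x (dx t)].

Section C1y_theory.
Context {R : realType}.
Implicit Types (x y dx dy : R -> R).

Lemma eq_C1y {x dx y dy} :
  x =1 y -> dx =1 dy -> C1y x dx -> C1y y dy.
Proof. by move=> /funext <- /funext <-. Qed.

Lemma C1y_cst (c : R) : C1y (fun=> c) (fun=> 0).
Proof.
by split=> [||t _]; [exact: cst_continuous..|exact: is_derive_cst].
Qed.

Lemma C1yD {x dx y dy} : C1y x dx -> C1y y dy ->
  C1y (fun t => x t + y t) (fun t => dx t + dy t).
Proof.
move=> [cx cdx xdx] [cy cdy ydy]; split=> [||t t0].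
- exact: within_continuousD cx cy.
- exact: within_continuousD cdx cdy.
- exact: is_deriveD (xdx t t0) (ydy t t0).
Qed.

Lemma within_continuousM {x y} (A : set R) :
  {within A, continuous x} -> {within A, continuous y} ->
  {within A, continuous (fun t => x t * y t)}.
Proof. by move=> cx cy t; apply: continuousM; [exact: cx|exact: cy]. Qed.

Lemma C1yM {x dx y dy} : C1y x dx -> C1y y dy ->
  C1y (fun t => x t * y t) (fun t => dx t * y t + x t * dy t).
Proof.
move=> [cx cdx xdx] [cy cdy ydy]; split=> [||t t0].
- exact: within_continuousM.
- by apply: within_continuousD; apply: within_continuousM.
- apply: is_derive_eq (is_deriveM (xdx t t0) (ydy t t0)) _.
  by rewrite /GRing.scale/= addrC mulrC.
Qed.

Lemma C1yZ (c : R) {x dx} : C1y x dx ->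
  C1y (fun t => c * x t) (fun t => c * dx t).
Proof.
move=> xdx; apply: eq_C1y (C1yM (C1y_cst c) xdx) => // t.
by rewrite mul0r add0r.
Qed.

Lemma C1y_sum {n} {x dx : 'I_n -> R -> R} : (forall i, C1y (x i) (dx i)) ->
  C1y (fun t => \sum_i x i t) (fun t => \sum_i dx i t).
Proof.
elim: n x dx => [|n IH] x dx xdx.
  by apply: eq_C1y (C1y_cst 0) => t; rewrite big_ord0.
have := C1yD (xdx ord0) (IH _ _ (fun i => xdx (lift ord0 i))).
by apply: eq_C1y => t; rewrite big_ord_recl.
Qed.

Lemma C1y_exp (k : R) : C1y (fun t => expR (k * t)) (fun t => k * expR (k * t)).
Proof.
have ce : continuous (fun t : R => expR (k * t)).
  move=> t; apply: continuous_comp; last exact: continuous_expR.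
  exact: mulrl_continuous.
split=> [||t _].
- exact: continuous_subspaceT.
- apply: within_continuousM; apply: continuous_subspaceT => //.
  by move=> t; exact: cvg_cst.
- have dk : is_derive t 1 (fun s : R => k * s) k.
    apply: is_derive_eq (is_deriveZ k (is_derive_id t 1)) _.
    by rewrite /GRing.scale/= mulr1.
  apply: is_derive_eq (is_derive1_comp (is_derive_expR (k * t)) dk) _.
  by rewrite mulrC.
Qed.

Lemma C1y_nincr {x dx} : C1y x dx -> (forall t, 0 <= t -> dx t <= 0) ->
  forall t, 0 <= t -> x t <= x 0.
Proof.
move=> [cx _ xdx] dx0 t t0.
apply: (@ler0_derive1_nincry _ x 0) => // s; rewrite in_itv/= andbT => s0.
  by have [] := xdx s s0.
by rewrite derive1E (@derive_val _ _ _ _ _ _ _ (xdx s s0)) dx0 ?ltW.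
Qed.

(** Gronwall argument: [x t * expR (k * t)] is nonincreasing, so [x] is squeezed between 0 and a
    decaying exponential. *)
Lemma exp_decay {x dx} {k : R} : 0 < k -> C1y x dx ->
  (forall t, 0 <= t -> 0 <= x t) ->
  (forall t, 0 <= t -> dx t <= - k * x t) ->
  x t @[t --> +oo%R] --> 0.
Proof.
move=> k0 xdx x_ge0 dx_le.
have bnd t : 0 <= t -> x t <= x 0 * expR (- (k * t)).
  move=> t0.
  have /C1y_nincr := C1yM xdx (C1y_exp k).
  move=> /(_ _ t t0); rewrite mulr0 expR0 mulr1 expRN ler_pdivlMr ?expR_gt0//.
  apply=> s s0; rewrite mulrCA mulrA -mulrDl.
  by rewrite pmulr_lle0 ?expR_gt0// -[k * _]opprK -mulNr subr_le0 dx_le.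
have lim0 : x 0 * expR (- (k * t)) @[t --> +oo%R] --> 0.
  rewrite -[X in _ --> X](mulr0 (x 0)); apply: cvgMl_tmp.
  apply: (@cvg_comp _ _ _ (fun t => k * t) (fun t => expR (- t)) _ +oo%R).
    exact: gt0_cvgMry.
  exact: cvgr_expR.
apply: (squeeze_cvgr _ (cvg_cst 0) lim0).
near=> t; have t0 : 0 <= t by near: t; exact: nbhs_pinfty_ge.
by rewrite x_ge0//= bnd.
Unshelve. all: by end_near.
Qed.

End C1y_theory.

(** * Improper integrals from Lyapunov functions *)

Section Lyapunov.
Context {R : realType}.
Local Notation mu := (@lebesgue_measure R).

Lemma C1y_integral {x dx : R -> R} : C1y x dx ->
  (forall t : R, 0 <= t -> dx t <= 0) -> x t @[t --> +oo%R] --> 0 ->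
  (\int[mu]_(t in `[0%R, +oo[) (- dx t)%:E = (x 0)%:E)%E.
Proof.
move=> xdx dx0 x_lim.
have [cx cdx dxE] : C1y (fun t => -1 * x t) (fun t => -1 * dx t) := C1yZ (-1) xdx.
under eq_integral do rewrite -mulN1r.
rewrite (ge0_continuous_FTC2y _ cdx (l := 0) (F := fun t => -1 * x t)).
- by rewrite mulN1r -EFinB sub0r opprK.
- by move=> t t0; rewrite mulN1r oppr_ge0 dx0.
- under eq_fun do rewrite mulN1r.
  by rewrite -oppr0; exact: cvgN.
- by move=> t t0; have [] := dxE t t0.
- by move/continuous_within_itvcyP : cx => [].
- move=> t; rewrite in_itv/= andbT => t0.
  by rewrite derive1E (@derive_val _ _ _ _ _ _ _ (dxE t t0)).
Qed.

(* [f] lies below [- (W + (e / k) T)'], which in turn lies below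
   [f - 2 (e / k) T']: both bounds of the integral come from integrating these
   exact derivatives. *)
Lemma lyapunov_integral (f n W dW T dT : R -> R) (e k r K : R) :
  {within `[0, +oo[, continuous f} -> (forall t : R, 0 <= t -> 0 <= f t) ->
  C1y W dW -> C1y T dT -> 0 <= e -> 0 < k -> 0 < r ->
  (forall t : R, 0 <= t -> 0 <= n t) ->
  (forall t : R, 0 <= t -> 0 <= T t) ->
  (forall t : R, 0 <= t -> `|W t| <= K * T t) ->
  (forall t : R, 0 <= t -> `|dW t + f t| <= e * n t) ->
  (forall t : R, 0 <= t -> dT t <= - k * n t) ->
  (forall t : R, 0 <= t -> dT t <= - r * T t) ->
  (`| \int[mu]_(t in `[0%R, +oo[) (f t)%:E - (W 0)%:E | <= (e / k * T 0)%:E)%E.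
Proof.
move=> cf f0 WdW TdT e0 k0 r0 n0 T0 WT dWf dTn dTT.
have T_lim : T t @[t --> +oo%R] --> 0 := exp_decay r0 TdT T0 dTT.
have W_lim : W t @[t --> +oo%R] --> 0.
  have KT_lim : K * T t @[t --> +oo%R] --> 0.
    by rewrite -[X in _ --> X](mulr0 K); exact: cvgMl_tmp.
  have NKT_lim : - (K * T t) @[t --> +oo%R] --> 0.
    by rewrite -oppr0; exact: cvgN.
  apply: (squeeze_cvgr _ NKT_lim KT_lim).
  near=> t; have t0 : 0 <= t by near: t; exact: nbhs_pinfty_ge.
  by rewrite -ler_norml WT.
have ek0 : 0 <= e / k by rewrite divr_ge0// ltW.
have dT_le0 t : 0 <= t -> dT t <= 0.
  move=> t0; apply: le_trans (dTn t t0) _.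
  by rewrite mulNr oppr_le0 mulr_ge0 ?(ltW k0)// n0.
have edT t : 0 <= t -> e / k * dT t <= - (e * n t).
  move=> t0; apply: le_trans (ler_wpM2l ek0 (dTn t t0)) _.
  by rewrite mulNr mulrN lerN2 mulrA divfK ?gt_eqF.
pose H t := W t + e / k * T t; pose dH t := dW t + e / k * dT t.
have HdH : C1y H dH := C1yD WdW (C1yZ _ TdT).
have f_le t : 0 <= t -> f t <= - dH t.
  move=> t0; have := edT t t0; have := dWf t t0; rewrite /dH.
  by rewrite ler_norml => /andP[]; lra.
have le_f t : 0 <= t -> - dH t <= f t + (2 * (e / k)) * - dT t.
  move=> t0; have := edT t t0; have := dWf t t0; rewrite /dH.
  by rewrite ler_norml => /andP[]; lra.
have mD : measurable (`[0%R, +oo[%classic : set R) by exact: measurable_itv.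
have mE (h : R -> R) : {within `[0, +oo[, continuous h} ->
    measurable_fun (`[0%R, +oo[ : set R) (EFin \o h).
  by move=> ch; apply/measurable_EFinP; exact: subspace_continuous_measurable_fun.
have cN (h : R -> R) : {within `[0, +oo[, continuous h} ->
    {within `[0, +oo[, continuous (fun t => - h t)}.
  by move=> ch t; apply: continuousN; exact: ch.
have D0 (t : R) : `[0%R, +oo[%classic t -> 0 <= t.
  by rewrite /= in_itv/= andbT.
have [_ cdH _] := HdH; have [_ cdT _] := TdT.
have intH : (\int[mu]_(t in `[0%R, +oo[) (- dH t)%:E = (H 0)%:E)%E.
  apply: (C1y_integral HdH) => [t t0|].
    by rewrite -oppr_ge0 (le_trans (f0 t t0))// f_le.
  rewrite -[X in _ --> X]addr0; apply: cvgD W_lim _.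
  by rewrite -[X in _ --> X](mulr0 (e / k)); exact: cvgMl_tmp.
have intT : (\int[mu]_(t in `[0%R, +oo[) (- dT t)%:E = (T 0)%:E)%E.
  exact: C1y_integral TdT dT_le0 T_lim.
set I := (X in `|X - _|%E).
have I_le : (I <= (H 0)%:E)%E.
  rewrite -intH; apply: ge0_le_integral => //.
  - by move=> t /D0 t0; rewrite lee_fin f0.
  - exact: (mE f).
  - exact: (mE _ (cN dH cdH)).
  - by move=> t /D0 t0; rewrite lee_fin f_le.
have le_I : ((H 0)%:E <= I + (2 * (e / k) * T 0)%:E)%E.
  rewrite -intH EFinM -intT -ge0_integralZl//.
  - rewrite -ge0_integralD//.
    + apply: ge0_le_integral => //.
      * by move=> t /D0 t0; rewrite lee_fin (le_trans (f0 t t0))// f_le.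
      * exact: (mE _ (cN dH cdH)).
      * apply: (mE (fun t => f t + 2 * (e / k) * - dT t)).
        apply: within_continuousD cf _.
        by apply: within_continuousM; [exact: cst_continuous|exact: cN].
      * by move=> t /D0 t0; rewrite -EFinM -EFinD lee_fin le_f.
    + by move=> t /D0 t0; rewrite lee_fin f0.
    + exact: (mE f).
    + move=> t /D0 t0; rewrite -EFinM lee_fin; apply: mulr_ge0.
        exact: mulr_ge0.
      by rewrite oppr_ge0; exact: dT_le0.
    + apply: (mE (fun t => 2 * (e / k) * - dT t)).
      by apply: within_continuousM; [exact: cst_continuous|exact: cN].
  - exact: (mE _ (cN dT cdT)).
  - by move=> t /D0 t0; rewrite lee_fin oppr_ge0 dT_le0.
  - by rewrite lee_fin mulr_ge0.
have I0 : (0 <= I)%E.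
  by apply: integral_ge0 => t /D0 t0; rewrite lee_fin f0.
(* The upper bound [H 0] rules out an infinite integral; what remains is that the integral lies
   within [e / k * T 0] of [W 0] on either side. *)
case: I I0 I_le le_I => [i||] //; rewrite ?leye_eq//.
rewrite !lee_fin => _ + +; rewrite /H ler_norml => ? ?.
by apply/andP; split; lra.
Unshelve. all: by end_near.
Qed.

End Lyapunov.

(** * Bounds that are uniform in a parameter *)

Definition dominated {R : realType} {S : Type} (P : set S) (r E : S -> R) :=
  exists K, forall s, P s -> `|E s| <= K * r s.

Section Dominated.
Context {R : realType} {S : Type} {P : set S}.
Implicit Types (r E : S -> R).

Lemma dominated_cst (c : R) : dominated P (fun=> 1) (fun=> c).
Proof. by exists `|c| => s _; rewrite mulr1. Qed.

Lemma eq_dominated {r E F} : E =1 F -> dominated P r E -> dominated P r F.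
Proof. by move=> EF [K EK]; exists K => s /EK; rewrite EF. Qed.

Lemma dominatedD {r E F} : dominated P r E -> dominated P r F ->
  dominated P r (fun s => E s + F s).
Proof.
move=> [K EK] [L FL]; exists (K + L) => s Ps.
by rewrite mulrDl (le_trans (ler_normD _ _))// lerD ?EK ?FL.
Qed.

Lemma dominatedM {r r' E F} : dominated P r E -> dominated P r' F ->
  dominated P (fun s => r s * r' s) (fun s => E s * F s).
Proof.
move=> [K EK] [L FL]; exists (K * L) => s Ps.
by rewrite mulrACA normrM ler_pM ?EK ?FL.
Qed.

Lemma dominatedZ {r E F} : dominated P (fun=> 1) E -> dominated P r F ->
  dominated P r (fun s => E s * F s).
Proof.
move=> dE dF; have [K EFK] := dominatedM dE dF.
by exists K => s /EFK; rewrite mul1r.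
Qed.

Lemma dominated_sum {n r} {E : 'I_n -> S -> R} :
  (forall i, dominated P r (E i)) -> dominated P r (fun s => \sum_i E i s).
Proof.
elim: n E => [|n IH] E dE.
  by exists 0 => s _; rewrite big_ord0 normr0 mul0r.
apply: eq_dominated (dominatedD (dE ord0) (IH _ (fun i => dE (lift ord0 i)))).
by move=> s; rewrite big_ord_recl.
Qed.

(** A constant enlarged to a positive one can be divided by. *)
Lemma dominated_gt0 {r E} : (forall s, 0 <= r s) -> dominated P r E ->
  exists2 K, 0 < K & forall s, P s -> `|E s| <= K * r s.
Proof.
move=> r0 [K EK]; exists (`|K| + 1) => [|s Ps]; first by rewrite ltr_wpDl.
apply: le_trans (EK s Ps) _; apply: ler_wpM2r => //.
by rewrite (le_trans (ler_norm K))// lerDl.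
Qed.

End Dominated.

(** * Modal dynamics and its quadratic Lyapunov functions *)

Section Modal.
Context {R : realType} {N : nat}.
Variables (gam : R) (lam : 'I_N -> R).
Hypotheses (gam_gt0 : 0 < gam) (lam_ge0 : forall al, 0 <= lam al).

(** Only modes with nonzero eigenvalue carry a deviation from the system frequency. At the zero mode
    [x] is frozen at 0, while [v] still evolves and drives the other modes through the coupling. *)
Let moving al : R := (lam al != 0)%:R.

(** This is the resultant of [s^2 + gam s + l] and [s^2 - gam s + k]. It vanishes exactly when the
    characteristic polynomials of the two modes have opposite roots, which is when the Lyapunov
    equation for the pair is singular. *)
Definition mode_gap (l k : R) : R := (l - k) ^+ 2 + 2 * gam ^+ 2 * (l + k).
Definition cross_vv l k := 2 * l * gam / mode_gap l k.
Definition cross_xv l k := (2 * gam * cross_vv l k - (l - k) * cross_vv l k / gam) / 2.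
Definition cross_vx l k := 2 * gam * cross_vv l k - 1 - cross_xv l k.
Definition cross_xx l k := gam * cross_vx l k + k * cross_vv l k.

Definition cross (l k x v x' v' : R) :=
  cross_xx l k * (x * x') + cross_xv l k * (x * v') +
  cross_vx l k * (v * x') + cross_vv l k * (v * v').

Definition dcross l k x dx v dv x' dx' v' dv' :=
  cross_xx l k * (dx * x' + x * dx') + cross_xv l k * (dx * v' + x * dv') +
  cross_vx l k * (dv * x' + v * dx') + cross_vv l k * (dv * v' + v * dv').

Lemma C1y_cross l k {x dx v dv x' dx' v' dv' : R -> R} :
  C1y x dx -> C1y v dv -> C1y x' dx' -> C1y v' dv' ->
  C1y (fun t => cross l k (x t) (v t) (x' t) (v' t))
      (fun t => dcross l k (x t) (dx t) (v t) (dv t)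
                           (x' t) (dx' t) (v' t) (dv' t)).
Proof.
move=> hx hv hx' hv'.
exact: (C1yD (C1yD (C1yD (C1yZ _ (C1yM hx hx')) (C1yZ _ (C1yM hx hv')))
  (C1yZ _ (C1yM hv hx'))) (C1yZ _ (C1yM hv hv'))).
Qed.

Lemma mode_gap_gt0 (l k : R) : 0 < l -> 0 <= k -> 0 < mode_gap l k.
Proof.
move=> l0 k0; rewrite /mode_gap ltr_wpDl ?sqr_ge0// !mulr_gt0 ?exprn_gt0//.
by rewrite ltr_pwDl.
Qed.

(* The coefficients of [cross l k] are determined by requiring its derivative
   along two uncoupled modes [l] and [k] to be [- (gam * x + v) * v'].
   If [k = 0] it does not involve [x']. *)
Lemma dcrossE (l k x v x' dx' v' f f' : R) : 0 < l -> 0 <= k ->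
  k = 0 \/ dx' = v' ->
  dcross l k x v v (- gam * v - l * x + f) x' dx' v' (- gam * v' - k * x' + f') =
  - (gam * x + v) * v' +
  ((cross_vx l k * x' + cross_vv l k * v') * f +
   (cross_xv l k * x + cross_vv l k * v) * f').
Proof.
move=> l0 k0 kdx; have g1 : gam != 0 by rewrite gt_eqF.
have l1 : l != 0 by rewrite gt_eqF.
have := mode_gap_gt0 _ _ l0 k0; move/lt0r_neq0.
rewrite /dcross /cross_xx /cross_vx /cross_xv /cross_vv /mode_gap => Q0.
case: kdx => [k00|->]; last by field; rewrite g1 Q0.
subst k; field; rewrite g1 andbT.
by apply: contra_neq Q0 => E; rewrite -[RHS]E; ring.
Qed.

Implicit Types (g : R) (V : 'I_N -> 'I_N -> R) (x v : 'I_N -> R).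

Definition coupling V v al := \sum_be V al be * v be.

(** Here [x] is a modal frequency and [v] a modal acceleration: the equation of motion has been
    differentiated once, which removes the constant forcing. *)
Definition accel g V x v al :=
  - gam * v al - lam al * x al - g * gam * coupling V v al.

(** Without coupling, the derivative of this form along a mode with [lam al != 0] is
    [- lam al * x al ^ 2]; the terms in [v al ^ 2] and [x al * v al] cancel. *)
Definition mode_energy x v al :=
  x al * v al + gam / 2 * x al ^+ 2 + (v al ^+ 2 + lam al * x al ^+ 2) / (2 * gam).

(* The factor [(lam al)^-1] vanishes at the zero mode, since [0^-1 = 0]. *)
Definition lyap g V x v :=
  \sum_al (lam al)^-1 * (mode_energy x v al -
    g * \sum_be V al be * cross (lam al) (lam be) (x al) (v al) (x be) (v be)).

Definition dlyap g V x v :=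
  let dx al := moving al * v al in let dv := accel g V x v in
  \sum_al (lam al)^-1 *
   (dx al * v al + x al * dv al + gam * (x al * dx al) +
     (v al * dv al + lam al * (x al * dx al)) / gam -
    g * \sum_be V al be *
      dcross (lam al) (lam be) (x al) (dx al) (v al) (dv al)
                               (x be) (dx be) (v be) (dv be)).

Definition remainder V x v :=
  \sum_al (lam al)^-1 * (gam * \sum_be V al be *
    ((cross_vx (lam al) (lam be) * x be + cross_vv (lam al) (lam be) * v be) *
       coupling V v al +
     (cross_xv (lam al) (lam be) * x al + cross_vv (lam al) (lam be) * v al) *
       coupling V v be)).

(** The coupling adds [- g * (gam * x al + v al) * coupling V v al] to the derivative of
    [mode_energy], and the [cross] terms are built to cancel it. What is left is the effect of the
    coupling on [cross] itself, hence the factor [g ^ 2]. *)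
Lemma dlyapE g V x v : (forall al, lam al = 0 -> x al = 0) ->
  dlyap g V x v + \sum_al x al ^+ 2 = g ^+ 2 * remainder V x v.
Proof.
move=> x0; rewrite /dlyap /remainder mulr_sumr -big_split; apply: eq_bigr => al _ /=.
have g1 : gam != 0 by rewrite gt_eqF.
have [l0|l1] := eqVneq (lam al) 0; first by rewrite l0 x0// invr0; ring.
have l0 : 0 < lam al by rewrite lt_def l1 lam_ge0.
have dcE be : dcross (lam al) (lam be) (x al) (moving al * v al) (v al)
      (accel g V x v al) (x be) (moving be * v be) (v be) (accel g V x v be) =
    - (gam * x al + v al) * v be - g * gam *
    ((cross_vx (lam al) (lam be) * x be + cross_vv (lam al) (lam be) * v be) *
       coupling V v al +
     (cross_xv (lam al) (lam be) * x al + cross_vv (lam al) (lam be) * v al) *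
       coupling V v be).
  rewrite {1}/moving l1 mul1r /accel dcrossE//; first ring.
  by rewrite /moving; case: eqVneq => [|_]; [left|right; rewrite mul1r].
under eq_bigr do rewrite dcE mulrDr mulrN !(mulrCA (V _ _)).
rewrite big_split/= sumrN -!mulr_sumr -/(coupling V v al).
rewrite /moving l1 mul1r /accel; field; exact/andP.
Qed.

(** Doubling the energy part of [mode_energy] makes the form strict: its derivative gains
    [- v al ^ 2]. The weight [(lam al)^-1] is absent, so that the [v] of the zero mode, which enters
    [remainder], is controlled as well. *)
Definition decay x v :=
  \sum_al (x al * v al + gam / 2 * x al ^+ 2 +
           (v al ^+ 2 + lam al * x al ^+ 2) / gam).

Definition ddecay g V x v :=
  let dx al := moving al * v al in let dv := accel g V x v in
  \sum_al (dx al * v al + x al * dv al + gam * (x al * dx al) +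
           2 * (v al * dv al + lam al * (x al * dx al)) / gam).

Definition decay_coupling V x v :=
  gam * \sum_al (x al + 2 * v al / gam) * coupling V v al.

Lemma ddecay_le g V x v : (forall al, lam al = 0 -> x al = 0) ->
  ddecay g V x v <=
  - \sum_al (v al ^+ 2 + lam al * x al ^+ 2) - g * decay_coupling V x v.
Proof.
move=> x0; rewrite /decay_coupling mulrA mulr_sumr -opprD -big_split/= -sumrN.
apply: ler_sum => al _; have g1 : gam != 0 by rewrite gt_eqF.
rewrite /moving /accel; case: eqVneq => [l0|l1]/=.
  (* With [x al = 0], the uncoupled zero mode contributes [- 2 * v al ^ 2], which leaves [v al ^ 2]
     to spare. *)
  rewrite l0 x0// -subr_ge0.
  by rewrite [X in 0 <= X](_ : _ = v al ^+ 2) ?sqr_ge0//; field.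
by rewrite le_eqVlt; apply/orP; left; apply/eqP; field.
Qed.

Definition sqnorm x v := \sum_al (x al ^+ 2 + v al ^+ 2).

Lemma sqnorm_ge0 x v : 0 <= sqnorm x v.
Proof. by apply: sumr_ge0 => al _; rewrite addr_ge0 ?sqr_ge0. Qed.

Lemma decay_ge : exists2 c : R, 0 < c &
  forall x v, c * sqnorm x v <= decay x v.
Proof.
(* Completing the square in [x al * v al] leaves the coefficients [gam / 8] and [(3 * gam)^-1]; this
   constant lies below both. *)
exists (gam / (8 * (1 + gam ^+ 2))).
  by rewrite divr_gt0// mulr_gt0// ltr_pwDl ?sqr_ge0.
move=> x v; rewrite mulr_sumr; apply: ler_sum => al _; rewrite mulrDr.
have g1 : gam != 0 by rewrite gt_eqF.
have q0 : 0 < 1 + gam ^+ 2 by rewrite ltr_pwDl ?sqr_ge0.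
rewrite [X in _ <= X](_ : _ = gam / 8 * x al ^+ 2 + (3 * gam)^-1 * v al ^+ 2 +
   (3 * gam / 8 * (x al + 4 * v al / (3 * gam)) ^+ 2 + lam al * x al ^+ 2 / gam));
  last by field.
rewrite -[leLHS]addr0; apply: lerD.
  apply: lerD; apply: ler_wpM2r; rewrite ?sqr_ge0//.
    rewrite ler_pM2l// lef_pV2 ?posrE ?mulr_gt0// ler_peMr// lerDl.
    exact: sqr_ge0.
  rewrite ler_pdivrMr ?mulr_gt0// mulrC ler_pdivlMr ?mulr_gt0//.
  have := sqr_ge0 gam; rewrite expr2; lra.
have g0 := ltW gam_gt0; apply: addr_ge0.
  by apply: mulr_ge0; [rewrite divr_ge0 ?mulr_ge0|exact: sqr_ge0].
by apply: divr_ge0 => //; apply: mulr_ge0 => //; exact: sqr_ge0.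
Qed.

Lemma lam_lower_bound : exists2 l : R, 0 < l <= 1 &
  forall al, lam al != 0 -> l <= lam al.
Proof.
have S0 : 0 <= \sum_al (lam al)^-1 by apply: sumr_ge0 => al _; rewrite invr_ge0.
(* Each [(lam al)^-1] is at most the sum, to which the zero mode adds [0^-1 = 0]. The 1 keeps the
   sum positive and the bound at most 1. *)
exists (1 + \sum_al (lam al)^-1)^-1.
  by rewrite invr_gt0 ltr_pwDl//= invf_le1 ?ltr_pwDl// lerDl.
move=> al l1; have l0 : 0 < lam al by rewrite lt_def l1 lam_ge0.
rewrite -[leRHS]invrK lef_pV2 ?posrE ?invr_gt0// ?ltr_pwDl//.
rewrite (bigD1 al)//= addrCA lerDl addr_ge0// sumr_ge0// => be _.
by rewrite invr_ge0.
Qed.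

(** The perturbation [(g, V)] and the phase point [(x, v)] form a single variable, so that the
    constants obtained from [dominated] do not depend on any of them. *)
Local Notation state :=
  ((R * ('I_N -> 'I_N -> R)) * (('I_N -> R) * ('I_N -> R)))%type.

(** * Quadratic bounds uniform in the damping *)

Section QuadraticBounds.
Variable CV : R.

Let bounded : set state :=
  [set s | `|s.1.1| <= 1 /\ forall al be, `|s.1.2 al be| <= CV].
Let n2 (s : state) := sqnorm s.2.1 s.2.2.
Let n1 (s : state) : R := Num.sqrt (n2 s).
Let lin := dominated bounded n1.
Let quad := dominated bounded n2.
Let scal := dominated bounded (fun=> 1 : R).

Let cstP (c : R) : scal (fun=> c). Proof. exact: dominated_cst. Qed.

Let gP : scal (fun s => s.1.1).
Proof. by exists 1 => s [g1 _]; rewrite mulr1. Qed.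

Let VP al be : scal (fun s => s.1.2 al be).
Proof. by exists CV => s [_ V1]; rewrite mulr1. Qed.

Let xP al : lin (fun s => s.2.1 al).
Proof.
exists 1 => s _; rewrite mul1r -sqrtr_sqr ler_wsqrtr// /n2 /sqnorm.
rewrite (bigD1 al)//= -addrA lerDl addr_ge0 ?sqr_ge0// sumr_ge0// => be _.
by rewrite addr_ge0 ?sqr_ge0.
Qed.

Let vP al : lin (fun s => s.2.2 al).
Proof.
exists 1 => s _; rewrite mul1r -sqrtr_sqr ler_wsqrtr// /n2 /sqnorm.
rewrite (bigD1 al)//= addrAC lerDr addr_ge0 ?sqr_ge0// sumr_ge0// => be _.
by rewrite addr_ge0 ?sqr_ge0.
Qed.

Let quadM E F : lin E -> lin F -> quad (fun s => E s * F s).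
Proof.
move=> dE dF; have [K EFK] := dominatedM dE dF; exists K => s /EFK.
by rewrite /n1 -expr2 sqr_sqrtr ?sqnorm_ge0.
Qed.

Let couplingP al : lin (fun s => coupling s.1.2 s.2.2 al).
Proof. by apply: dominated_sum => be; apply: dominatedZ; [exact: VP|exact: vP]. Qed.

Let crossP l k al be : quad (fun s =>
  cross l k (s.2.1 al) (s.2.2 al) (s.2.1 be) (s.2.2 be)).
Proof.
by do ![apply: dominatedD]; apply: dominatedZ; do ?[exact: cstP];
  apply: quadM; do ?[exact: xP | exact: vP].
Qed.

Let quad_energy (a b c : R) al : quad (fun s =>
  s.2.1 al * s.2.2 al + a * s.2.1 al ^+ 2 +
  (s.2.2 al ^+ 2 + b * s.2.1 al ^+ 2) / c).
Proof.
apply: dominatedD; first apply: dominatedD.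
- by apply: quadM; [exact: xP|exact: vP].
- by apply: dominatedZ; [exact: cstP|apply: quadM; exact: xP].
- apply: eq_dominated (fun=> mulrC _ _) _.
  apply: dominatedZ; first exact: cstP.
  apply: dominatedD; first by apply: quadM; exact: vP.
  by apply: dominatedZ; [exact: cstP|apply: quadM; exact: xP].
Qed.

Lemma quad_lyap : quad (fun s => lyap s.1.1 s.1.2 s.2.1 s.2.2).
Proof.
apply: dominated_sum => al; apply: dominatedZ; first exact: cstP.
apply: dominatedD; first exact: quad_energy.
apply: (eq_dominated (fun s => mulNr _ _)); apply: dominatedZ.
  by apply: (eq_dominated (fun s => mulN1r _)); apply: dominatedZ; [exact: cstP|exact: gP].
apply: dominated_sum => be; apply: dominatedZ; [exact: VP|exact: crossP].
Qed.

Lemma quad_remainder : quad (fun s => remainder s.1.2 s.2.1 s.2.2).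
Proof.
apply: dominated_sum => al; apply: dominatedZ; first exact: cstP.
apply: dominatedZ; first exact: cstP.
apply: dominated_sum => be; apply: dominatedZ; first exact: VP.
have lin2 (a b : R) ga de : lin (fun s => a * s.2.1 ga + b * s.2.2 de).
  by apply: dominatedD; apply: dominatedZ; [exact: cstP|exact: xP|exact: cstP|exact: vP].
by apply: dominatedD; apply: quadM;
  [exact: lin2|exact: couplingP|exact: lin2|exact: couplingP].
Qed.

Lemma quad_decay : quad (fun s => decay s.2.1 s.2.2).
Proof. by apply: dominated_sum => al; exact: quad_energy. Qed.

Lemma quad_decay_coupling : quad (fun s => decay_coupling s.1.2 s.2.1 s.2.2).
Proof.
apply: dominatedZ; first exact: cstP.
apply: dominated_sum => al; apply: quadM; last exact: couplingP.
apply: dominatedD; first exact: xP.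
apply: (eq_dominated (fun s => mulrC _ _)); apply: dominatedZ; first exact: cstP.
by apply: dominatedZ; [exact: cstP|exact: vP].
Qed.

End QuadraticBounds.

Definition modal_trajectory g V (x v : 'I_N -> R -> R) :=
  [/\ forall al t, lam al = 0 -> x al t = 0,
      forall al, C1y (x al) (fun t => moving al * v al t) &
      forall al, C1y (v al) (fun t => accel g V (x^~ t) (v^~ t) al)].

Lemma C1y_energy (a b c : R) {x dx v dv : R -> R} : C1y x dx -> C1y v dv ->
  C1y (fun t => x t * v t + a / 2 * x t ^+ 2 + (v t ^+ 2 + b * x t ^+ 2) / c)
      (fun t => dx t * v t + x t * dv t + a * (x t * dx t) +
                2 * (v t * dv t + b * (x t * dx t)) / c).
Proof.
move=> hx hv; have := C1yD (C1yD (C1yM hx hv) (C1yZ (a / 2) (C1yM hx hx)))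
  (C1yM (C1yD (C1yM hv hv) (C1yZ b (C1yM hx hx))) (C1y_cst c^-1)).
by apply: eq_C1y => t; [rewrite !expr2|move: (c^-1) => ci; field].
Qed.

Lemma C1y_decay {g V} {x v : 'I_N -> R -> R} : modal_trajectory g V x v ->
  C1y (fun t => decay (x^~ t) (v^~ t)) (fun t => ddecay g V (x^~ t) (v^~ t)).
Proof. by move=> [_ hx hv]; apply: C1y_sum => al; exact: C1y_energy. Qed.

Lemma C1y_lyap {g V} {x v : 'I_N -> R -> R} : modal_trajectory g V x v ->
  C1y (fun t => lyap g V (x^~ t) (v^~ t)) (fun t => dlyap g V (x^~ t) (v^~ t)).
Proof.
move=> [_ hx hv]; apply: C1y_sum => al; apply: C1yZ.
have hc := C1y_sum (fun be => C1yZ (V al be)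
  (C1y_cross (lam al) (lam be) (hx al) (hv al) (hx be) (hv be))).
have := C1yD (C1y_energy gam (lam al) (2 * gam) (hx al) (hv al)) (C1yZ (- g) hc).
apply: eq_C1y => t; first by rewrite mulNr.
rewrite mulNr; congr (_ + _ - _); have g1 : gam != 0 by rewrite gt_eqF.
by field.
Qed.

(** This is [lyapunov_integral] with [lyap] as [W] and [decay] as [T]: [dlyapE] supplies the error
    [KR * g ^ 2], and [decay] absorbs it with constants independent of [g] and [V]. *)
Lemma modal_expansion (CV : R) : exists2 d : R, 0 < d & exists K : R,
  forall g V (x v : 'I_N -> R -> R), `|g| <= d ->
    (forall al be, `|V al be| <= CV) -> modal_trajectory g V x v ->
  (`| \int[@lebesgue_measure R]_(t in `[0%R, +oo[) (\sum_al x al t ^+ 2)%:E -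
      (lyap g V (x^~ 0) (v^~ 0))%:E |
    <= (K * g ^+ 2 * sqnorm (x^~ 0) (v^~ 0))%:E)%E.
Proof.
have n0 (s : state) : 0 <= sqnorm s.2.1 s.2.2 by exact: sqnorm_ge0.
have [KW KW0 WP] := dominated_gt0 n0 (quad_lyap CV).
have [KR KR0 RP] := dominated_gt0 n0 (quad_remainder CV).
have [KT KT0 TP] := dominated_gt0 n0 (quad_decay CV).
have [KQ KQ0 QP] := dominated_gt0 n0 (quad_decay_coupling CV).
have [c c0 T_ge] := decay_ge.
have [l /andP[l0 l1] lP] := lam_lower_bound.
(* The bound 1 puts [g] in the domain of the quadratic estimates; [l / 2 / KQ] lets the coupling
   consume at most half of the decay rate [l]. *)
exists (Num.min 1 (l / 2 / KQ)).
  by rewrite lt_min ltr01/= !divr_gt0.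
exists (KR / (l / 2) * KT) => g V x v.
rewrite le_min => /andP[g1 gl] VCV traj; have [x0 hx hv] := traj.
pose s t : state := ((g, V), (x^~ t, v^~ t)).
have Ps t : `|(s t).1.1| <= 1 /\ forall al be, `|(s t).1.2 al be| <= CV by [].
pose n t := sqnorm (x^~ t) (v^~ t).
have x0' t al : lam al = 0 -> x al t = 0 by exact: x0.
have T_le t : decay (x^~ t) (v^~ t) <= KT * n t.
  exact: le_trans (ler_norm _) (TP _ (Ps t)).
have dT_le t : ddecay g V (x^~ t) (v^~ t) <= - (l / 2) * n t.
  apply: le_trans (ddecay_le _ _ _ _ (x0' t)) _.
  (* The [v] part uses [l <= 1]; the [x] part uses [l <= lam al], or [x al = 0] at the zero mode. *)
  have lN : l * n t <= \sum_al (v al t ^+ 2 + lam al * x al t ^+ 2).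
    rewrite mulr_sumr; apply: ler_sum => al _; rewrite mulrDr addrC lerD//.
      by rewrite ler_piMl ?sqr_ge0.
    have [la0|la] := eqVneq (lam al) 0; first by rewrite x0// la0 expr0n !mulr0.
    by rewrite ler_wpM2r ?sqr_ge0 ?lP.
  have gQ : `|g * decay_coupling V (x^~ t) (v^~ t)| <= l / 2 * n t.
    rewrite normrM; have := QP _ (Ps t); rewrite /= -/(n t) => Qn.
    apply: le_trans (ler_pM _ _ gl Qn) _ => //.
    by rewrite mulrA divfK ?gt_eqF.
  by move: gQ; rewrite ler_norml => /andP[]; lra.
have l20 : 0 < l / 2 by rewrite divr_gt0.
apply: (@le_trans _ _ ((KR * g ^+ 2) / (l / 2) * decay (x^~ 0) (v^~ 0))%:E).
  apply: (@lyapunov_integral R _ n _ _ (fun t => decay (x^~ t) (v^~ t)) _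
    (KR * g ^+ 2) (l / 2) (l / 2 / KT) (KW / c) _ _
    (C1y_lyap traj) (C1y_decay traj)) => //.
  - by have [] := C1y_sum (fun al => C1yM (hx al) (hx al)).
  - by move=> t _; apply: sumr_ge0 => al _; exact: sqr_ge0.
  - by rewrite mulr_ge0 ?sqr_ge0 ?ltW.
  - by rewrite divr_gt0.
  - by move=> t _; exact: sqnorm_ge0.
  - by move=> t _; apply: le_trans (T_ge _ _); rewrite mulr_ge0 ?(ltW c0)// sqnorm_ge0.
  - move=> t _; apply: le_trans (WP _ (Ps t)) _; rewrite -mulrA ler_pM2l//=.
    by rewrite mulrC ler_pdivlMr// mulrC; exact: T_ge.
  - move=> t _; rewrite dlyapE; last exact: x0'.
    rewrite normrM ger0_norm ?sqr_ge0// [leRHS]mulrAC [leLHS]mulrC.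
    by apply: ler_wpM2r; [exact: sqr_ge0|exact: RP (s t) (Ps t)].
  - move=> t _; apply: le_trans (dT_le t) _; rewrite !mulNr lerN2 -[leLHS]mulrA.
    by rewrite ler_pM2l// mulrC ler_pdivrMr// mulrC; exact: T_le.
rewrite lee_fin [leRHS](_ : _ = KR * g ^+ 2 / (l / 2) * (KT * n 0)).
  apply: ler_wpM2l; last exact: T_le.
  by rewrite divr_ge0 ?(ltW l20)// mulr_ge0 ?sqr_ge0 ?(ltW KR0).
by rewrite /n; field; rewrite gt_eqF.
Qed.

End Modal.

(** * Spectrum of the weighted Laplacian *)

Section Spectrum.
Context {R : realType} {N : nat}.
Implicit Types (B L u : 'M[R]_N) (lam : 'I_N -> R).

Lemma laplacian_tr B th0 : B^T = B -> (laplacian B th0)^T = laplacian B th0.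
Proof.
move=> BT; apply/matrixP => i j; rewrite !mxE eq_sym; case: eqVneq => [->//|_].
by rewrite -[B in LHS]BT mxE -opprB cosN.
Qed.

Lemma laplacian_row_sum B th0 i : B i i = 0 -> \sum_j laplacian B th0 i j = 0.
Proof.
move=> Bii; rewrite (bigD1 i)//= mxE eqxx (bigD1 i)//= Bii mul0r add0r.
rewrite -big_split/= big1// => j ji; rewrite mxE eq_sym (negPf ji).
by rewrite addrN.
Qed.

Lemma inertia_weightedE m L i j : 0 < m ->
  inertia_weighted (fun=> m) L i j = L i j / m.
Proof.
move=> m0; rewrite /inertia_weighted /diag_of mul_mx_diag mul_diag_mx !mxE.
by rewrite mulrC mulrA -invfM -expr2 sqr_sqrtr ?ltW// mulrC.
Qed.

Lemma parseval u (y z : 'I_N -> R) : u *m u^T = 1%:M ->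
  \sum_al (\sum_i u al i * y i) * (\sum_i u al i * z i) = \sum_i y i * z i.
Proof.
move=> /mulmx1C uu; pose Y := \col_i y i; pose Z := \col_i z i.
have /matrixP/(_ 0 0) : (u *m Y)^T *m (u *m Z) = Y^T *m Z.
  by rewrite trmx_mul mulmxA -(mulmxA Y^T) uu mulmx1.
rewrite !mxE => E; transitivity (\sum_j Y^T 0 j * Z j 0).
  rewrite -E; apply: eq_bigr => al _; rewrite !mxE.
  by congr (_ * _); apply: eq_bigr => i _; rewrite !mxE.
by apply: eq_bigr => i _; rewrite !mxE.
Qed.

Section SpectralData.
Context {B : 'M[R]_N} {th0 : 'I_N -> R} {m : R} {lam : 'I_N -> R} {u : 'M[R]_N}.
Let L := laplacian B th0.
Hypotheses (m_gt0 : 0 < m) (BT : B^T = B) (B0 : forall i, B i i = 0).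
Hypothesis spec : spectral_data (inertia_weighted (fun=> m) L) lam u.

Lemma spectral_gt0 (al : 'I_N) : (0 < al)%N -> 0 < lam al.
Proof.
case: spec => _ _ lam0 lam_lt al0; have N0 : (0 < N)%N by apply: leq_trans (ltn_ord al).
by rewrite -(lam0 (Ordinal N0) erefl) lam_lt.
Qed.

Lemma spectral_eq0 (al : 'I_N) : (lam al == 0) = ((al : nat) == 0)%N.
Proof.
case: spec => _ _ lam0 _; case: (posnP al) => [al0|al0].
  by rewrite lam0 ?eqxx.
by rewrite gt_eqF ?spectral_gt0.
Qed.

Lemma spectral_ge0 al : 0 <= lam al.
Proof.
have [/eqP|al0] := posnP al; first by rewrite -spectral_eq0 => /eqP ->.
by rewrite ltW ?spectral_gt0.
Qed.

Lemma spectral_left al j : \sum_i u al i * (L i j / m) = lam al * u al j.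
Proof.
have rowE k : (row al u)^T k 0 = u al k by rewrite !mxE.
have LT i : L i j = L j i.
  by have /matrixP/(_ j i) := laplacian_tr B th0 BT; rewrite mxE.
case: spec => _ /(_ al)/matrixP/(_ j 0) + _ _.
rewrite mxE [in X in _ = X -> _]mxE rowE => <-.
by apply: eq_bigr => i _; rewrite inertia_weightedE// rowE mulrC LT.
Qed.

Lemma spectral_norm1 al i : `|u al i| <= 1.
Proof.
case: spec => uu _ _ _; rewrite -(@ler_pXn2r _ 2)// ?nnegrE// expr1n.
rewrite -normrX ger0_norm ?sqr_ge0//.
have /matrixP/(_ al al) := uu; rewrite !mxE eqxx mulr1n => <-.
rewrite (bigD1 i)//= !mxE -expr2 lerDl sumr_ge0// => j _.
by rewrite !mxE -expr2 sqr_ge0.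
Qed.

(** The constant vector is in the kernel of the symmetric matrix [L], hence orthogonal to the
    eigenvectors of nonzero eigenvalue. *)
Lemma spectral_sum0 al : lam al != 0 -> \sum_i u al i = 0.
Proof.
move=> al0; apply: (mulfI al0); rewrite mulr0 mulr_sumr.
under eq_bigr do rewrite -spectral_left; rewrite exchange_big/= big1// => i _.
by rewrite -mulr_sumr -mulr_suml laplacian_row_sum ?mul0r ?mulr0.
Qed.

(** Subtracting the mean projects out the zero mode: it is the only mode of eigenvalue 0, as [lam]
    is strictly increasing, and the components of every other mode sum to 0. *)
Lemma spectral_deviation (y : 'I_N -> R) al :
  \sum_i u al i * (y i - (\sum_j y j) / N%:R) =
  (lam al != 0)%:R * \sum_i u al i * y i.
Proof.
have N0 : (N%:R : R) != 0.
  by rewrite pnatr_eq0 -lt0n; apply: leq_trans (ltn_ord al).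
case: spec => uu _ _ _; case: eqVneq => [al0|al0]; last first.
  under eq_bigr do rewrite mulrBr.
  by rewrite sumrB -mulr_suml spectral_sum0// mul0r subr0 mul1r.
(* In Parseval's identity against the constant vector only the zero mode survives. Taking [z = 1]
   shows that its components have a nonzero sum, so a vector of zero sum has no component along
   it. *)
have only_al (z z' : 'I_N -> R) : (forall i, z' i = 1) ->
    (\sum_i u al i * z i) * (\sum_i u al i) = \sum_i z i.
  move=> z'1; transitivity (\sum_i z i * z' i); last first.
    by apply: eq_bigr => i _; rewrite z'1 mulr1.
  rewrite -(parseval u z z' uu) [RHS](bigD1 al)//= [X in _ = _ + X]big1 ?addr0.
    by congr (_ * _); apply: eq_bigr => i _; rewrite z'1 mulr1.
  move=> be be_al; have be0 : lam be != 0.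
    apply: contra_neq be_al => /eqP; rewrite spectral_eq0 => /eqP be0.
    by apply/val_inj; move/eqP: al0; rewrite spectral_eq0 /= be0 => /eqP.
  under [X in _ * X]eq_bigr do rewrite z'1 mulr1.
  by rewrite spectral_sum0// mulr0.
have S0 : \sum_i u al i != 0.
  apply: contra_neq N0 => S0; have := only_al (fun=> 1) (fun=> 1) (fun=> erefl).
  by rewrite S0 mulr0 sumr_const card_ord.
apply: (mulIf S0); rewrite mul0r (only_al _ (fun=> 1))// mul0r.
by rewrite sumrB sumr_const card_ord -(mulr_natr (_ / _)) divfK// subrr.
Qed.

End SpectralData.
End Spectrum.

(** * Response to the power loss *)

Section Response.
Context {R : realType} {N : nat}.
Variables (L : 'M[R]_N) (m dP : R) (d : 'I_N -> R) (b : 'I_N).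
Variables (dth om : R -> 'cV[R]_N).
Hypothesis m_gt0 : 0 < m.
Hypothesis resp : response L (fun=> m) d (power_loss b dP) dth om.

(** The equation of motion solved for the acceleration, with the step function replaced by 1. This
    expression is continuous up to [t = 0], where it gives the acceleration just after the jump. *)
Definition omdot i t : R :=
  dP / m * (i == b)%:R - d i / m * om t i 0 - \sum_j L i j / m * dth t j 0.

Lemma C1y_dth i : C1y (fun t => dth t i 0) (fun t => om t i 0).
Proof.
case: resp => _ _ cdth com eqs; split=> // t /eqs[ddth _ /matrixP/(_ i 0)+ _].
rewrite mxE derive1E => <-; exact: DeriveDef.
Qed.

Lemma C1y_om i : C1y (fun t => om t i 0) (omdot i).
Proof.
case: resp => _ _ cdth com eqs; split=> // [|t t0].
  have [cth _ _] := C1y_sum (fun j => C1yZ (L i j / m) (C1y_dth j)).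
  apply: within_continuousB cth; apply: within_continuousB.
    exact: cst_continuous.
  by apply: within_continuousM (com i); exact: cst_continuous.
have [_ /(_ i) dom _ /matrixP/(_ i 0)] := eqs t t0.
rewrite /diag_of !mul_diag_mx !mxE /heaviside t0 mulr1 derive1E => E.
apply: is_derive_eq (DeriveDef dom erefl) _.
have m1 : m != 0 by rewrite gt_eqF.
apply: (mulfI m1); rewrite /omdot !mulrBr mulr_sumr.
under eq_bigr do rewrite mulrA (mulrC m) divfK//.
move: E => /eqP; rewrite eq_sym -subr_eq => /eqP <-.
by field.
Qed.

Lemma C1y_omdot i :
  C1y (omdot i) (fun t => - (d i / m) * omdot i t - \sum_j L i j / m * om t j 0).
Proof.
have := C1yD (C1yD (C1y_cst (dP / m * (i == b)%:R)) (C1yZ (- (d i / m)) (C1y_om i)))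
  (C1yZ (-1) (C1y_sum (fun j => C1yZ (L i j / m) (C1y_dth j)))).
by apply: eq_C1y => t; rewrite ?add0r mulN1r// /omdot mulNr.
Qed.

Lemma omdot0 i : omdot i 0 = dP / m * (i == b)%:R.
Proof.
case: resp => dth0 om0 _ _ _; rewrite /omdot dth0 om0 mxE mulr0 subr0.
by rewrite big1 ?subr0// => j _; rewrite mxE mulr0.
Qed.

End Response.

(** * Reduction of the grid to its modes *)

Section GridModes.
Context {R : realType} {N : nat}.
Variables (B : 'M[R]_N) (th0 : 'I_N -> R) (b : 'I_N) (m gam dP : R).
Variables (lam : 'I_N -> R) (u : 'M[R]_N).
Let L := laplacian B th0.
Let mi := fun _ : 'I_N => m.
Hypotheses (m_gt0 : 0 < m) (gam_gt0 : 0 < gam).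
Hypotheses (BT : B^T = B) (B0 : forall i, B i i = 0).
Hypothesis spec : spectral_data (inertia_weighted mi L) lam u.

(** The entries of [diag(a)] in the eigenbasis. *)
Definition mode_coupling (a : 'I_N -> R) al be := \sum_i u al i * a i * u be i.

Lemma mode_coupling_le a al be : in_box a -> `|mode_coupling a al be| <= N%:R.
Proof.
move=> a1; apply: le_trans (ler_norm_sum _ _ _) _.
have -> : N%:R = \sum_(i < N) (1 : R) by rewrite sumr_const card_ord.
apply: ler_sum => i _; rewrite !normrM.
have u1 be' : `|u be' i| <= 1 := spectral_norm1 spec be' i.
have a1i : `|a i| <= 1 by rewrite ler_norml a1.
by rewrite !mulr_ile1 ?mulr_ge0.
Qed.

Section Trajectory.
Variables (g : R) (a : 'I_N -> R) (dth om : R -> 'cV[R]_N).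
Let d := placement m gam (g * gam) a.
Hypothesis resp : response L mi d (power_loss b dP) dth om.

Let w al t : R := \sum_i u al i * om t i 0.
Let x al t : R := (lam al != 0)%:R * w al t.
Let v al t : R := \sum_i u al i * omdot L m dP d b dth om i t.

Lemma grid_modal_trajectory :
  modal_trajectory gam lam g (mode_coupling a) x v.
Proof.
have m1 : m != 0 by rewrite gt_eqF.
split=> [al t l0|al|al].
- by rewrite /x l0 eqxx mul0r.
- by apply: C1yZ; apply: C1y_sum => i; apply: C1yZ; exact: C1y_om.
have := C1y_sum (fun i => C1yZ (u al i) (C1y_omdot L m dP d b dth om m_gt0 resp i)).
apply: eq_C1y => // t; under eq_bigr do rewrite mulrBr.
rewrite sumrB /accel.
have -> : \sum_i u al i * (\sum_j L i j / m * om t j 0) = lam al * x al t.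
  have -> : lam al * x al t = lam al * w al t.
    by rewrite /x mulrA; case: eqVneq => [->|_]; rewrite ?mul0r ?mulr1.
  under eq_bigr do rewrite mulr_sumr; rewrite exchange_big/= mulr_sumr.
  apply: eq_bigr => j _; rewrite mulrA -(spectral_left m_gt0 BT spec) mulr_suml.
  by apply: eq_bigr => i _; rewrite mulrA.
(* Parseval's identity carries out the sum over [be] and returns to the buses. *)
have -> : coupling (mode_coupling a) (v^~ t) al =
    \sum_i u al i * a i * omdot L m dP d b dth om i t.
  case: spec => uu _ _ _; rewrite -(parseval u _ _ uu); apply: eq_bigr => be _.
  by congr (_ * _); apply: eq_bigr => i _; rewrite mulrC.
rewrite /v !mulr_sumr addrAC -sumrB; congr (_ - _).
by apply: eq_bigr => i _; rewrite /d /placement; field.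
Qed.

(** For homogeneous inertia [sys_freq] is the plain mean, so [spectral_deviation] and Parseval's
    identity turn the integrand into a sum over the nonzero modes. *)
Lemma performance_modes :
  performance mi om =
  (m%:E * \int[@lebesgue_measure R]_(t in `[0%R, +oo[) (\sum_al x al t ^+ 2)%:E)%E.
Proof.
have [_ hx _] := grid_modal_trajectory.
rewrite -ge0_integralZl//.
- apply: eq_integral => t _; rewrite -EFinM; congr _%:E.
  rewrite /= /diag_of mul_mx_diag !mxE.
  transitivity (m * \sum_i (om t i 0 - sys_freq mi om t) ^+ 2).
    by rewrite mulr_sumr; apply: eq_bigr => i _; rewrite !mxE /mi; ring.
  congr (_ * _); case: (spec) => uu _ _ _.
  under eq_bigr do rewrite expr2.
  rewrite -(parseval u _ _ uu); apply: eq_bigr => al _; rewrite -expr2; congr (_ ^+ 2).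
  rewrite /x /w -(spectral_deviation m_gt0 BT B0 spec).
  have m1 : m != 0 by rewrite gt_eqF.
  have N0 : (N%:R : R) != 0.
    by rewrite pnatr_eq0 -lt0n; apply: leq_trans (ltn_ord al).
  apply: eq_bigr => i _; congr (_ * (_ - _)).
  rewrite /sys_freq sumr_const card_ord -(mulr_natr m) -mulr_sumr.
  by field; rewrite m1 N0.
- apply/measurable_EFinP; apply: subspace_continuous_measurable_fun => //.
  by have [] := C1y_sum (fun al => C1yM (hx al) (hx al)).
- by move=> t _; rewrite lee_fin sumr_ge0// => al _; exact: sqr_ge0.
- by rewrite lee_fin ltW.
Qed.

Lemma grid_initial al : x al 0 = 0 /\ v al 0 = u al b * (dP / m).
Proof.
split.
  case: resp => _ om0 _ _ _; rewrite /x /w big1 ?mulr0// => i _.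
  by rewrite om0 mxE mulr0.
rewrite /v (bigD1 b)//= (omdot0 L m dP d b dth om resp) eqxx mulr1.
rewrite [X in _ + X]big1 ?addr0// => i ib.
by rewrite (omdot0 L m dP d b dth om resp) (negPf ib) !mulr0.
Qed.

End Trajectory.

Definition base_performance : R :=
  m * \sum_al (lam al)^-1 * ((u al b * (dP / m)) ^+ 2 / (2 * gam)).

(** As [x] vanishes initially, only the [cross_vv] part of [cross] contributes. The terms [be = al],
    where [cross_vv] equals [1 / (2 * gam)], form the first sum of [sensitivity]. The others form
    the double sum, in which the numerator of [cross_vv] cancels [(lam al)^-1]. *)
Lemma lyap_initial g a :
  m * lyap gam lam g (mode_coupling a) (fun=> 0) (fun al => u al b * (dP / m)) =
  base_performance + \sum_i sensitivity m gam dP lam u b g i * a i.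
Proof.
have m1 : m != 0 by rewrite gt_eqF.
have g1 : gam != 0 by rewrite gt_eqF.
pose z al := u al b * (dP / m).
pose H al be i := - (m * g * (lam al)^-1 * cross_vv gam (lam al) (lam be) *
  z al * z be) * (u al i * a i * u be i).
have -> : m * lyap gam lam g (mode_coupling a) (fun=> 0) z =
    base_performance + \sum_al \sum_i \sum_be H al be i.
  rewrite /base_performance [LHS]mulr_sumr [X in _ = X + _]mulr_sumr -big_split.
  apply: eq_bigr => al _ /=.
  rewrite exchange_big/= /mode_energy [LHS]mulrA mulrBr; congr (_ + _).
    by rewrite -/(z al); move: (lam al)^-1 => li; field.
  rewrite mulr_sumr mulr_sumr -sumrN; apply: eq_bigr => be _.
  rewrite /mode_coupling mulr_suml !mulr_sumr -sumrN; apply: eq_bigr => i _.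
  by rewrite /H /cross; ring.
congr (_ + _); rewrite exchange_big/=; apply: eq_bigr => i _.
rewrite /sensitivity -big_split/= mulr_sumr mulr_suml [RHS]big_mkcond/=.
apply: eq_bigr => al _; case: posnP => [al0|al0].
  (* [sensitivity] omits the zero mode, and so does [lyap] because [0^-1 = 0]. *)
  have /eqP l0 : lam al == 0 by rewrite (spectral_eq0 spec) al0.
  by apply: big1 => be _; rewrite /H l0 invr0; ring.
have l0 := spectral_gt0 spec _ al0; have l1 : lam al != 0 by rewrite gt_eqF.
rewrite (bigD1 al)//= mulrDr mulrDl mulr_sumr mulr_suml; congr (_ + _).
  rewrite /H /z /cross_vv /mode_gap subrr expr0n add0r; field.
  by rewrite l1 m1 g1 gt_eqF ?addr_gt0.
apply: eq_bigr => be _; rewrite /H /z /cross_vv.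
have := mode_gap_gt0 _ gam_gt0 _ _ l0 (spectral_ge0 spec be).
by rewrite /mode_gap => /lt0r_neq0 Q0; field; rewrite m1 Q0 l1 g1.
Qed.

End GridModes.

(** * Optimality of the sorted placement *)

Section SortedPlacement.
Context {R : realType} {N : nat}.
Implicit Types (al a : 'I_N -> R) (s : 'S_N).

Lemma sorted_assignment_admissible {s a} : sorted_assignment s a -> admissible a.
Proof.
move=> sa; split=> [i|].
  rewrite -(permKV s i) sa; case: ifP => _; first by lra.
  by case: ifP => _; lra.
rewrite (reindex_inj (@perm_inj _ s))/=.
(* Reversing the sorted order exchanges the values 1 and -1, so the sum is its own opposite. *)
have rev_sum : \sum_i a (s i) = - \sum_i a (s i).
  rewrite {1}(reindex_inj rev_ord_inj)/= -sumrN; apply: eq_bigr => i _.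
  rewrite !sa /=; have := ltn_ord i; have := odd_double_half N; rewrite -addnn.
  case: (ltnP i N./2) => h1; case: (ltnP (N - i.+1)%N N./2) => h2;
  case: (leqP (N - N./2)%N i) => h3; case: (leqP (N - N./2)%N (N - i.+1)%N) => h4;
  rewrite ?oppr0 ?opprK//; move: h1 h2 h3 h4; case: (odd N) => /=; lia.
by apply/eqP; rewrite -[_ == 0](mulrn_eq0 _ 2) mulr2n {2}rev_sum subrr.
Qed.

(* Each term [(al i - tau) * (a i - a' i)] is nonpositive when [tau] is the
   median sensitivity, and [tau] drops out because both placements sum to 0. *)
Lemma sorted_assignment_minimizes {al s a} :
  ascending al s -> sorted_assignment s a -> minimizes_linear_order al a.
Proof.
move=> asc sa; have adm := sorted_assignment_admissible sa; split=> // a' [box' sum'].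
have [_ sum0] := adm.
case: (posnP N) => [N0|N0].
  by rewrite !big1 => [//|i _|i _]; exfalso; have := ltn_ord i; lia.
have half : (N./2 < N)%N by rewrite ltn_half_double -addnn -ltn_subLR ?subnn.
pose tau := al (s (Ordinal half)).
have shift c : \sum_i c i = 0 -> \sum_i al i * c i = \sum_i (al i - tau) * c i.
  move=> c0; under [RHS]eq_bigr do rewrite mulrBl.
  by rewrite sumrB -mulr_sumr c0 mulr0 subr0.
rewrite (shift a)// (shift a')// (reindex_inj (@perm_inj _ s))/=.
rewrite [leRHS](reindex_inj (@perm_inj _ s))/=; apply: ler_sum => i _.
have /andP[a'ge a'le] := box' (s i); rewrite sa.
case: ltnP => [ilt|ige].
  by apply: ler_wnM2l => //; rewrite subr_le0 asc//= ltnW.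
case: leqP => [ihigh|ilow].
  by apply: ler_wpM2l => //; rewrite subr_ge0 asc.
(* Here [N./2 <= i < N - N./2], which forces [N] to be odd and [i] to be the median position
   [N./2]. *)
have -> : s i = s (Ordinal half).
  congr (s _); apply/val_inj/eqP => /=; rewrite eqn_leq ige andbT.
  have := odd_double_half N; rewrite -addnn; case: (odd N) ilow => /=; lia.
by rewrite subrr !mul0r.
Qed.

End SortedPlacement.

(** * From the expansion to optimality at leading order *)

Lemma optimal_of_sensitivities {R : realType} {N : nat}
    {F : R -> ('I_N -> R) -> \bar R} {alpha : R -> 'I_N -> R}
    (C : R -> set ('I_N -> R)) :
  are_sensitivities F alpha ->
  (forall g a, C g a -> minimizes_linear_order (alpha g) a) ->
  optimal_to_leading_order F C.
Proof.
move=> [_ [M0 expansion]] C_min e e0.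
(* [M0] cancels between the expansions at [a] and at [a'], and each of them costs [e / 2]. *)
have [|dlt dlt0 dltP] := expansion (e / 2); first by rewrite divr_gt0.
exists dlt => // g a gd /C_min[adm min]; split=> // a' adm'.
have := dltP g a gd adm.1; have := dltP g a' gd adm'.1; have := min a' adm'.
case: (F g a) => [r||] //; case: (F g a') => [r'||] //.
rewrite -!EFinB !lee_fin !ler_norml => ? /andP[? ?] /andP[? ?]; lra.
Qed.

(** The response is given for positive dampings, and [|g| < 1] ensures positivity over the whole
    box. *)
Lemma placement_gt0 {R : realType} {N : nat} {m gam g : R} {a : 'I_N -> R} i :
  0 < m -> 0 < gam -> `|g| < 1 -> in_box a -> 0 < placement m gam (g * gam) a i.
Proof.
move=> m0 gam0 g1 a1; rewrite mulr_gt0// -[X in X + _]mul1r mulrAC -mulrDl mulr_gt0//.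
have ga : `|g * a i| < 1.
  rewrite normrM; apply: le_lt_trans g1; apply: ler_piMr => //.
  by rewrite ler_norml a1.
by move: ga; rewrite ltr_norml => /andP[]; lra.
Qed.

Lemma performance_expansion {R : realType} {N : nat}
    {B : 'M[R]_N} {th0 : 'I_N -> R} {b : 'I_N} {m gam dP : R}
    {lam : 'I_N -> R} {u : 'M[R]_N}
    {dth om : ('I_N -> R) -> R -> 'cV[R]_N} :
  let mi := fun _ : 'I_N => m in
  let L := laplacian B th0 in
  B^T = B -> (forall i, B i i = 0) -> 0 < m -> 0 < gam ->
  spectral_data (inertia_weighted mi L) lam u ->
  (forall d : 'I_N -> R, (forall i, 0 < d i) ->
     response L mi d (power_loss b dP) (dth d) (om d)) ->
  are_sensitivities
    (fun g a => performance mi (om (placement m gam (g * gam) a)))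
    (sensitivity m gam dP lam u b).
Proof.
move=> mi L BT B0 m0 gam0 spec resp; split.
  by move=> g i; rewrite /sensitivity; ring.
exists (base_performance b m gam dP lam u) => e e0.
have [d d0 [K expansion]] := modal_expansion gam lam gam0 (spectral_ge0 spec) N%:R.
pose z al := u al b * (dP / m).
(* The modal expansion, multiplied by [m], errs by at most [C * g ^ 2], and [|g| < e / C] turns this
   into [e * |g|]; the added 1 makes [C] positive. *)
pose C := `|m * K * sqnorm (fun=> 0) z| + 1.
have C0 : 0 < C by rewrite ltr_wpDl.
exists (Num.min (Num.min d 1) (e / C)).
  by rewrite !lt_min d0 ltr01 divr_gt0.
move=> g a; rewrite !lt_min => /andP[/andP[gd g1] gC] a1.
have {}resp := resp _ (fun i => placement_gt0 i m0 gam0 g1 a1).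
have traj := grid_modal_trajectory B th0 b m gam dP lam u m0 BT spec g a _ _ resp.
have init al := grid_initial B th0 b m gam dP lam u g a _ _ resp al.
rewrite -(lyap_initial B th0 b m gam dP lam u m0 gam0 spec) -/z.
have mc al be := mode_coupling_le B th0 m lam u spec a al be a1.
have := expansion g _ _ _ (ltW gd) mc traj.
set xs := (X in modal_trajectory _ _ _ _ X _) in traj *.
set vs := (X in modal_trajectory _ _ _ _ _ X) in traj *.
have -> : xs^~ 0 = (fun=> 0) by apply/funext => al; exact: (init al).1.
have -> : vs^~ 0 = z by apply/funext => al; exact: (init al).2.
set I := (X in `|X - _|%E); set l := lyap _ _ _ _ _ _.
rewrite (_ : performance _ _ = (m%:E * I)%E); last first.
  exact: performance_modes B th0 b m gam dP lam u m0 BT B0 spec g a _ _ resp.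
case: I => [r||] //; rewrite -EFinM -!EFinB !lee_fin => rl.
rewrite -mulrBr normrM gtr0_norm//.
apply: (@le_trans _ _ (m * (K * g ^+ 2 * sqnorm (fun=> 0) z))).
  by rewrite ler_pM2l.
rewrite (_ : _ * _ = m * K * sqnorm (fun=> 0) z * `|g| * `|g|); last first.
  by rewrite -real_normK ?num_real//; ring.
apply: ler_wpM2r => //; apply: (@le_trans _ _ (C * `|g|)).
  by apply: ler_wpM2r => //; apply: le_trans (ler_norm _) _; rewrite lerDl.
by rewrite mulrC -ler_pdivlMr// ltW.
Qed.

Theorem theorem2 (R : realType) (N : nat)
    (B : 'M[R]_N) (th0 : 'I_N -> R) (b : 'I_N) (m gam dP : R)
    (lam : 'I_N -> R) (u : 'M[R]_N)
    (dth om : ('I_N -> R) -> R -> 'cV[R]_N) :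
  let mi := fun _ : 'I_N => m in
  let L := laplacian B th0 in
  let Mb := fun (g : R) (a : 'I_N -> R) => performance mi (om (placement m gam (g * gam) a)) in
  let alpha := sensitivity m gam dP lam u b in
  connected_grid B ->
  0 < m -> 0 < gam ->
  spectral_data (inertia_weighted mi L) lam u ->
  (forall d : 'I_N -> R, (forall i, 0 < d i) ->
     response L mi d (power_loss b dP) (dth d) (om d)) ->
  [/\ are_sensitivities Mb alpha,
      forall g s a, ascending (alpha g) s -> sorted_assignment s a ->
        minimizes_linear_order (alpha g) a &
      optimal_to_leading_order Mb
        (fun g a => exists2 s : 'S_N,
           ascending (alpha g) s & sorted_assignment s a)].
Proof.
move=> mi L Mb alpha [BT B0 _] m0 gam0 spec resp.
have sens : are_sensitivities Mb alpha.
  exact: performance_expansion BT B0 m0 gam0 spec resp.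
split=> // [g s a|]; first exact: sorted_assignment_minimizes.
apply: (optimal_of_sensitivities _ sens) => g a [s].
exact: sorted_assignment_minimizes.
Qed.
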